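(* Let $\bar{\mathbf{a}},\hat{\mathbf{a}}\in\mathbb{R}^n$, $h\in\mathbb{R}$, and let $Z$ be a real random variable whose distribution lies in $$\mathcal{P}=\{\mathbb{P} : \mathbb{P}(Z\in[-1,1])=1,\ \mathbb{E}_{\mathbb{P}}[Z]=0,\ \mathbb{E}_{\mathbb{P}}[|Z|]=d\}$$ for some $d\in[0,1]$. For any $\epsilon\in(0,\tfrac12)$ and $\mathbf{x}\in\mathbb{R}^n$ it holds that $$\inf_{\mathbb{P}\in\mathcal{P}}\mathbb{P}\big((\bar{\mathbf{a}}+Z\hat{\mathbf{a}})^\top\mathbf{x}\le h\big)\ge 1-\epsilon$$ if and only if $$\bar{\mathbf{a}}^\top\mathbf{x}+\min\Big\{1,\ \frac{d}{2\epsilon}\Big\}\cdot|\hat{\mathbf{a}}^\top\mathbf{x}|\le h.$$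
   Context: $\mathcal{P}$ ranges over all Borel probability measures on $\mathbb{R}$ (distributions of $Z$) with the listed properties. *)

(* Defs.v *)
From HB Require Import structures.
From mathcomp Require Import all_boot all_order all_algebra.
From mathcomp Require Import all_classical all_reals all_analysis.

Set Implicit Arguments.
Unset Strict Implicit.
Unset Printing Implicit Defensive.
Import Order.TTheory GRing.Theory Num.Theory.
Import numFieldNormedType.Exports.

Local Open Scope classical_set_scope.
Local Open Scope ring_scope.

Definition dotp (R : realType) (n : nat) (u v : 'cV[R]_n) : R :=
  (u^T *m v) ord0 ord0.

(* The law of Z is a Borel probability measure on R, so Z is the identity
   coordinate z |-> z.  Both expectations are extended-real Lebesgue integrals;
   the support condition makes the integrands integrable. *)
Definition ambiguity_set (R : realType) (d : R) :
    set (probability (measurableTypeR R) R) :=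
  [set P : probability (measurableTypeR R) R |
    [/\ P [set z : R | -1 <= z <= 1] = 1%E,
        ('E_P[fun z : R => z] = 0)%E
      & ('E_P[fun z : R => `|z|%R] = d%:E)%E]].

Definition worst_case_prob (R : realType) (n : nat) (d : R)
    (abar ahat x : 'cV[R]_n) (h : R) : \bar R :=
  ereal_inf [set P [set z : R | dotp (abar + z *: ahat) x <= h] | P in ambiguity_set d].

(* Main.v *)
Require Import Defs.
From HB Require Import structures.
From mathcomp Require Import all_boot all_order all_algebra.
From mathcomp Require Import all_classical all_reals all_analysis.
From mathcomp Require Import measurable_realfun ring lra.
Import Order.TTheory GRing.Theory Num.Theory.
Import numFieldNormedType.Exports.
Local Open Scope classical_set_scope.
Local Open Scope ring_scope.

(** Only the scalars a, the product of abar and x, and b, the product of ahat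
and x, matter: the constraint holds at z exactly when a + z b <= h.  Let
m := min (1, d / (2 eps)).

If a + m |b| <= h, a violation at z forces m < k z, where k is the sign of b.
Thus it suffices that every admissible law gives mass at most eps to this tail
(tail_bound).  Since Z has mean zero, the mean of |Z| + k Z is still d, while
|z| + k z is nonnegative everywhere and at least 2 m on the tail: a Markov
argument gives 2 m P(m < k Z) <= d (two_sided_markov).  The factor 2 expresses
that each side of zero carries only half of E|Z|.  This settles the case
m = d / (2 eps) > 0; if m = 1 the tail lies outside the support, and if m = 0
then d = 0 and Z vanishes almost surely.

If h < a + m |b|, an admissible law breaks the chance constraint.  Let k be a
sign with k b = |b|, and put mass p at k s, mass d / 2 at - k, and the remaining
mass at 0, with p s = d / 2.  The mean is zero and the mean absolute value is d
(three_point_law).  The constraint fails at the atom k s as soon as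
h < a + s |b|, so its probability is at most 1 - p, and everything reduces to
finding p > eps and s = d / (2 p) <= 1 with this property
(exists_violating_atom).  Such a choice exists because s tends to m as p
decreases to max (eps, d / 2), and because eps < 1/2 leaves room for p + d / 2
to stay below 1. *)

(** * Reduction to scalars *)

Lemma dotp_affine (R : realType) (n : nat) (u v x : 'cV[R]_n) (z : R) :
  dotp (u + z *: v) x = dotp u x + z * dotp v x.
Proof.
by rewrite /dotp linearD linearZ /= mulmxDl -scalemxAl !mxE.
Qed.

(** The parameters of a violating law: an atom of mass p at distance s from 0,
carrying half of the mean absolute value d, with b the absolute slope.  The
hypothesis is strict and the excess depends continuously on p, so a mass
strictly above eps can be afforded. *)
Lemma exists_violating_atom (R : realType) (d eps a b h : R) :
  0 <= d <= 1 -> 0 < eps < 2^-1 -> 0 <= b ->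
  h < a + Num.min 1 (d / (2 * eps)) * b ->
  exists p s : R, [/\ eps < p, p + d / 2 <= 1, 0 <= s <= 1, 2 * p * s = d
    & h < a + s * b].
Proof.
move=> /andP[d0 d1] /andP[e0 e2] b0.
have [ed|de] := ltP eps (d / 2).
  (* The mass d / 2 already exceeds eps, so the atom can sit at the endpoint. *)
  rewrite min_l; last by rewrite ler_pdivlMr; lra.
  move=> hab; exists (d / 2), 1; split; lra.
rewrite min_r; last by rewrite ler_pdivrMr; lra.
move=> hab.
have hab' : 2 * eps * (h - a) < d * b.
  have : h - a < d / (2 * eps) * b by lra.
  rewrite mulrAC ltr_pdivlMr; lra.
(* Now s = d / (2 p) is at most 1 for every p > eps, and the bound p <= 1/2
   leaves room for the opposite atom, as d / 2 <= 1/2. *)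
suff [p [ep p2 hp]] : exists p : R, [/\ eps < p, p <= 2^-1 & 2 * p * (h - a) < d * b].
  have p0 : 0 < p by lra.
  exists p, (d / (2 * p)); split => //; first lra.
  - by rewrite divr_ge0 ?ler_pdivrMr; lra.
  - by field; lra.
  - suff : h - a < d / (2 * p) * b by lra.
    by rewrite mulrAC ltr_pdivlMr; lra.
have [c0|c0] := leP (h - a) 0.
  exists 2^-1; split => //.
  have db0 : 0 <= d * b by rewrite mulr_ge0.
  have [c0'|] := ltP (h - a) 0; first lra.
  move=> c0'; have hE : h - a = 0 by lra.
  by move: hab'; rewrite hE !mulr0.
(* The mass t makes h = a + d / (2 p) * b; any p in ]eps, t[ works. *)
pose t := d * b / (2 * (h - a)).
have et : eps < t by rewrite /t ltr_pdivlMr; lra.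
exists (Num.min 2^-1 ((eps + t) / 2)); split.
- by rewrite lt_min; apply/andP; split; lra.
- by rewrite ge_min lexx.
- apply: (@le_lt_trans _ _ ((eps + t) * (h - a))).
    rewrite ler_wpM2r ?(ltW c0)//.
    have : Num.min 2^-1 ((eps + t) / 2) <= (eps + t) / 2 by rewrite ge_min lexx orbT.
    lra.
  have : t * (2 * (h - a)) = d * b by rewrite /t; field; lra.
  have : eps * (h - a) < t * (h - a) by rewrite ltr_pM2r.
  lra.
Qed.


(** * Laws with finitely many atoms *)

Section finite_law.
Context {disp : measure_display} {T : measurableType disp} {R : realType}.
Variables (n : nat) (w : nat -> {nonneg R}) (a : nat -> T).

Definition finite_law : set T -> \bar R :=
  msum (fun i => mscale (w i) (\d_ (a i))) n.

HB.instance Definition _ := Measure.on finite_law.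

Lemma finite_lawE (A : set T) :
  finite_law A = (\sum_(i < n) (w i)%:num * \1_A (a i))%:E.
Proof.
by rewrite /finite_law /msum/= -sumEFin; apply: eq_bigr => i _; rewrite EFinM.
Qed.

Lemma ge0_integral_finite_law (f : T -> \bar R) :
  measurable_fun setT f -> (forall z, (0 <= f z)%E) ->
  (\int[finite_law]_z f z = \sum_(i < n) (w i)%:num%:E * f (a i))%E.
Proof.
move=> mf f0; rewrite ge0_integral_measure_sum//.
apply: eq_bigr => i _; rewrite ge0_integral_mscale//.
by rewrite integral_dirac// diracT mul1e.
Qed.

(** Additivity and scaling of the integral in the measure are used for
nonnegative integrands only, so a signed integrand is split into its positive
and negative parts. *)
Lemma integral_finite_law (f : T -> R) :
  measurable_fun setT f ->
  (\int[finite_law]_z (f z)%:E = (\sum_(i < n) (w i)%:num * f (a i))%:E)%E.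
Proof.
move=> mf; have mF : measurable_fun setT (EFin \o f) by exact/measurable_EFinP.
rewrite integralE !ge0_integral_finite_law//=; first last.
- exact: measurable_funepos.
- exact: measurable_funeneg.
under eq_bigr do rewrite funeposE -EFin_max -EFinM.
under [X in (_ - X)%E]eq_bigr do rewrite funenegE -EFinN -EFin_max -EFinM.
rewrite !sumEFin -EFinB -sumrB; congr EFin.
apply: eq_bigr => i _; rewrite -mulrBr; congr (_ * _).
by have [?|?] := leP (f (a i)) 0; have [?|?] := leP (- f (a i)) 0; lra.
Qed.

Hypothesis w1 : \sum_(i < n) (w i)%:num = 1.

Let finite_law_setT : finite_law setT = 1%E.
Proof.
by rewrite finite_lawE -w1; congr EFin; apply: eq_bigr => i _; rewrite indicT mulr1.
Qed.

Definition finite_probability : probability T R :=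
  HB.pack finite_law (Measure_isProbability.Build _ _ _ finite_law finite_law_setT).

End finite_law.

(** * Failure of the constraint above the threshold *)

(** The masses p at [k * s] and d / 2 at [- k] balance because [p * s = d / 2],
and the atom at 0 fills the total mass up to 1. *)
Lemma three_point_law (R : realType) (d p s k : R) :
  0 <= p -> 0 <= d -> p + d / 2 <= 1 -> 0 <= s <= 1 -> 2 * p * s = d -> `|k| = 1 ->
  exists2 P, ambiguity_set d P &
    forall A : set R, ~ A (k * s) -> (P A <= (1 - p)%:E)%E.
Proof.
move=> p0 d0 pd s01 psd k1.
have q0 : 0 <= d / 2 by lra.
have r0 : 0 <= 1 - p - d / 2 by lra.
pose w i := match i with 0 => NngNum p0 | 1 => NngNum q0 | _ => NngNum r0 end.
pose a i : measurableTypeR R := match i with 0 => k * s | 1 => - k | _ => 0 end.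
have w1 : \sum_(i < 3) (w i)%:num = 1 by rewrite !big_ord_recr big_ord0/=; lra.
exists (@finite_probability _ _ _ 3 w a w1).
  split.
  - rewrite [LHS](finite_lawE 3 w a) !big_ord_recr big_ord0/= !indicE !mem_set ?mulr1/=.
    + by congr EFin; lra.
    + lra.
    + by rewrite -ler_norml normrN k1.
    + by rewrite -ler_norml normrM k1 mul1r ger0_norm; lra.
  - rewrite unlock [LHS](integral_finite_law 3 w a) //.
    by rewrite !big_ord_recr big_ord0/=; congr EFin; rewrite -[in d/2]psd; lra.
  - rewrite unlock [LHS](integral_finite_law 3 w a) //.
    rewrite !big_ord_recr big_ord0/= normr0 normrN normrM k1 ger0_norm; last lra.
    by congr EFin; lra.
move=> A Aks; rewrite [leLHS](finite_lawE 3 w a) lee_fin.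
rewrite !big_ord_recr big_ord0/= !indicE memNset//= mulr0 !add0r.
have ind (b : bool) : b%:R <= 1 :> R by case: b.
have := ler_wpM2l q0 (ind (- k \in A)); have := ler_wpM2l r0 (ind (0 \in A)).
lra.
Qed.

(** * Tails of the admissible laws *)

Section tail.
Context {R : realType} (d : R) (P : probability (measurableTypeR R) R).
Hypothesis Pd : ambiguity_set d P.

Lemma measurable_halfline (k t : R) :
  measurable ([set z | t < k * z] : set (measurableTypeR R)).
Proof.
rewrite [X in measurable X](_ : _ = (fun z => k * z) @^-1` `]t, +oo[%classic).
  rewrite -[X in measurable X]setTI.
  by apply: measurable_funM => //; exact: measurable_itv.
by apply/seteqP; split => z /=; rewrite in_itv/= andbT.
Qed.

Lemma tail_eq0 (k t : R) : `|k| <= 1 -> 1 <= t -> P [set z | t < k * z] = 0%E.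
Proof.
move=> k1 t1; have [supp _ _] := Pd.
pose I := [set z : measurableTypeR R | -1 <= z <= 1].
have mI : measurable I.
  rewrite (_ : I = `[-1, 1]%classic); first exact: measurable_itv.
  by apply/seteqP; split => z /=; rewrite in_itv.
have PI : P (~` I) = 0%E by rewrite probability_setC// supp subee.
apply: (subset_measure0 (measurable_halfline k t) (measurableC mI) _ PI).
move=> z /= tz; rewrite /I /= -ler_norml => z1.
have := ler_norm (k * z); rewrite normrM.
have := ler_pM (normr_ge0 _) (normr_ge0 _) k1 z1; lra.
Qed.

Lemma integrable_id : P.-integrable setT (EFin : measurableTypeR R -> \bar R).
Proof.
have [_ _ ] := Pd; rewrite unlock => absE.
by apply/integrableP; split => //=; rewrite absE ltry.
Qed.

(** The mean of |Z| + k Z is d by centering; this function is nonnegative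
because |k| <= 1, and is at least 2 t where t < k z, since |z| >= k z. *)
Lemma two_sided_markov (k t : R) : `|k| <= 1 -> 0 <= t ->
  ((2 * t)%:E * P [set z | (t < k * z)%R] <= d%:E)%E.
Proof.
move=> k1 t0; have [_ mean absE] := Pd; move: mean absE; rewrite !unlock => mean absE.
have mE := measurable_halfline k t.
have iid := integrable_id.
have -> : d%:E = (\int[P]_z (`|z| + k * z)%:E)%E.
  transitivity (\int[P]_z (`|z|%:E + k%:E * z%:E))%E; last exact: eq_integral.
  rewrite integralD//.
  - by rewrite absE integralZl// mean mule0 adde0.
  - exact: (integrable_abse iid).
  - exact: integrableZl.
have kz (z : R) : - (k * z) <= `|z|.
  have := ler_norm (- (k * z)); rewrite normrN normrM => h.
  by apply: le_trans h _; rewrite ler_piMl.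
rewrite -[X in P X]setIT -integral_indic// -ge0_integralZl_EFin//; last 2 first.
- by apply/measurable_EFinP; exact: measurable_indic.
- by lra.
apply: ge0_le_integral => //.
- by move=> z _; rewrite -EFinM lee_fin mulr_ge0//; lra.
- by apply/measurable_EFinP; exact: measurable_funM.
- by apply/measurable_EFinP; apply: measurable_funD => //; exact: measurable_funM.
move=> z _; rewrite -EFinM lee_fin indicE.
case: (boolP (z \in _)) => [|_]; last by rewrite mulr0; have := kz z; lra.
rewrite inE/= mulr1 => tz; have : k * z <= `|z|.
  by apply: le_trans (ler_norm _) _; rewrite normrM ler_piMl.
lra.
Qed.

Lemma tail_zero_dispersion (k : R) : d = 0 -> P [set z | 0 < k * z] = 0%E.
Proof.
move=> d0; have [_ _ ] := Pd; rewrite unlock d0 => absE.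
have : ae_eq P setT (EFin : measurableTypeR R -> \bar R) (cst 0%E).
  by apply/ae_eq_integral_abs.
move=> [N [mN PN sub]].
apply: (subset_measure0 (measurable_halfline k 0) mN _ PN).
move=> z /= kz; apply: sub => /= /(_ I) [z0].
by move: kz; rewrite z0 mulr0 ltxx.
Qed.

(** The three cases are those of the threshold: beyond the support, at zero
(where Markov's inequality is void), and in between. *)
Lemma tail_bound (eps k : R) : 0 <= d -> 0 < eps -> `|k| <= 1 ->
  (P [set z | (Num.min 1 (d / (2 * eps)) < k * z)%R] <= eps%:E)%E.
Proof.
move=> d0 e0 k1; have [le1|lt1] := leP 1 (d / (2 * eps)).
  by rewrite tail_eq0// lee_fin ltW.
have [dz|dn0] := eqVneq d 0; first by rewrite dz mul0r tail_zero_dispersion ?lee_fin ?ltW.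
have dp : 0 < d by rewrite lt_neqAle eq_sym dn0.
have m0 : 0 < d / (2 * eps) by rewrite divr_gt0//; lra.
have := two_sided_markov _ _ k1 (ltW m0).
have dE : d%:E = ((2 * (d / (2 * eps)))%:E * eps%:E)%E.
  by rewrite -EFinM; congr EFin; field; lra.
by rewrite [X in (_ <= X)%E]dE lee_pmul2l// lte_fin; lra.
Qed.

End tail.

(** * The equivalence *)

Theorem theorem11 (R : realType) (n : nat) (abar ahat : 'cV[R]_n) (h d : R)
    (hd : 0 <= d <= 1) (eps : R) (heps : 0 < eps < 2^-1) (x : 'cV[R]_n) :
  ((1 - eps)%:E <= worst_case_prob d abar ahat x h)%E
  <->
  dotp abar x + Num.min 1 (d / (2 * eps)) * `|dotp ahat x| <= h.
Proof.
rewrite /worst_case_prob (_ : mkset _ =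
    [set z | dotp abar x + z * dotp ahat x <= h]); last first.
  by apply/seteqP; split => z /=; rewrite dotp_affine.
set a := dotp abar x; set b := dotp ahat x; set m := Num.min 1 _.
have [[d0 d1] [e0 e2]] := (andP hd, andP heps).
split=> [robust|ab].
  rewrite leNgt; apply/negP => hab.
  have [p [s [ep pd s01 psd has]]] := exists_violating_atom _ _ _ _ _ _ hd heps (normr_ge0 b) hab.
  (* Num.sg b would vanish at b = 0, while the mean absolute value of the
     three-point law is d only for a direction of norm 1. *)
  pose k : R := if 0 <= b then 1 else -1.
  have k1 : `|k| = 1 by rewrite /k; case: ifP => _; rewrite ?normrN normr1.
  have kb : k * b = `|b|.
    rewrite /k; case: (leP 0 b) => b0; first by rewrite mul1r ger0_norm.
    by rewrite mulN1r ltr0_norm.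
  have p0 : 0 <= p by lra.
  have [P Pd Ple] := three_point_law _ _ _ _ _ p0 d0 pd s01 psd k1.
  have : ~ [set z | a + z * b <= h] (k * s).
    by move=> /=; rewrite mulrAC kb [`|b| * s]mulrC; apply/negP; rewrite -ltNge.
  move=> /Ple Ph.
  have : ((1 - eps)%:E <= (1 - p)%:E)%E.
    apply: le_trans robust _; apply: le_trans Ph.
    by apply: ereal_inf_lbound; exists P.
  rewrite lee_fin; lra.
apply: le_ereal_inf_tmp => _ [P Pd <-].
have k1 : `|Num.sg b| <= 1 by rewrite normr_sg; case: (b != 0).
have tail := tail_bound _ _ Pd _ _ d0 e0 k1.
have mE := measurable_halfline (Num.sg b) m.
apply: (@le_trans _ _ (P (~` [set z | m < Num.sg b * z]))).
  by rewrite probability_setC// EFinB leeB//.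
apply: le_measure; rewrite ?inE.
- exact: measurableC.
- rewrite (_ : mkset _ = ~` [set z | h - a < b * z]).
    exact: measurableC (measurable_halfline b (h - a)).
  apply/seteqP; split => z /=; first by move=> ?; apply/negP; lra.
  by move=> /negP; lra.
move=> z /= /negP; rewrite -leNgt => zm.
have : z * b <= m * `|b|.
  by rewrite [in z * b](numEsg b) mulrA [z * _]mulrC ler_wpM2r.
lra.
Qed.
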